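(* Let $m,n\in\mathbb{Z}_{>0}$, and let $\boldsymbol{u}\in\mathbb{R}_{>0}^m$, $\boldsymbol{v}\in\mathbb{R}_{>0}^n$ with $\|\boldsymbol{u}\|_1=\|\boldsymbol{v}\|_1=1$. Let $\rho\ge 0$ and $\varepsilon,\kappa\in(0,1]$. Let $C\in\mathbb{R}_{>0}^{m\times n}$ and $\eta>0$ be such that $\eta C$ is $(\rho,\kappa)$-well-bounded with respect to $(\boldsymbol{u},\boldsymbol{v})$. Then, with input $(\mathrm{diag}(\boldsymbol{u})\cdot\exp(-\eta C)\cdot\mathrm{diag}(\boldsymbol{v}),(\boldsymbol{u},\boldsymbol{v}))$ (exponential applied entrywise), the SK algorithm outputs a matrix $A$ satisfying $$\|\boldsymbol{r}(A)-\boldsymbol{u}\|_1+\|\boldsymbol{c}(A)-\boldsymbol{v}\|_1\le\varepsilon$$ within $O\bigl(e^{14\rho}\,\kappa^{-6}\,(\rho-\log\varepsilon-\log\kappa)\bigr)$ iterations.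
   Context: For a nonnegative matrix $A\in\mathbb{R}_{\ge0}^{m\times n}$, $r_i(A)=\sum_j A_{ij}$, $c_j(A)=\sum_i A_{ij}$, $\boldsymbol{r}(A)$, $\boldsymbol{c}(A)$ the vectors of row and column sums. SK algorithm: given nonzero $A\in\mathbb{R}_{\ge0}^{m\times n}$ and positive $\boldsymbol{u},\boldsymbol{v}$ with $\|\boldsymbol{u}\|_1=\|\boldsymbol{v}\|_1$, it produces $A^{(0)}_{ij}=u_iA_{ij}/r_i(A)$; for odd $k$, $A^{(k)}_{ij}=v_jA^{(k-1)}_{ij}/c_j(A^{(k-1)})$; for even $k\ge2$, $A^{(k)}_{ij}=u_iA^{(k-1)}_{ij}/r_i(A^{(k-1)})$. ''SK outputs a matrix satisfying $P$ within $T$ iterations'' means some $A^{(k)}$ with $k\le T$ satisfies $P$. $O(\cdot)$ hides an absolute constant. For $M\in\mathbb{R}^{m\times n}$: $r_\rho(M;\boldsymbol{v})=\min_{i}\sum_{j}v_j\mathbf{1}[M_{ij}\le\rho]$, $c_\rho(M;\boldsymbol{u})=\min_{j}\sum_{i}u_i\mathbf{1}[M_{ij}\le\rho]$; $M$ is $(\rho,\kappa)$-well-bounded with respect to $(\boldsymbol{u},\boldsymbol{v})$ if $r_\rho(M;\boldsymbol{v})+c_\rho(M;\boldsymbol{u})\ge1+\kappa$. *)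

(* Defs.v *)
From HB Require Import structures.
From mathcomp Require Import all_boot all_order all_algebra.
From mathcomp Require Import all_classical all_reals all_analysis.
Set Implicit Arguments.
Unset Strict Implicit.
Unset Printing Implicit Defensive.
Import Order.TTheory GRing.Theory Num.Theory.
Local Open Scope ring_scope.

Definition row_sums (R : realType) (m n : nat) (A : 'M[R]_(m, n)) : 'rV[R]_m :=
  \row_i \sum_j A i j.

Definition col_sums (R : realType) (m n : nat) (A : 'M[R]_(m, n)) : 'rV[R]_n :=
  \row_j \sum_i A i j.

(* The library norm on ['rV[R]_n] is the sup norm, hence a separate l1 norm. *)
Definition norm1 (R : realType) (n : nat) (x : 'rV[R]_n) : R :=
  \sum_i `|x 0 i|.

Definition row_scale (R : realType) (m n : nat) (u : 'rV[R]_m)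
    (A : 'M[R]_(m, n)) : 'M[R]_(m, n) :=
  \matrix_(i, j) (u 0 i * A i j / row_sums A 0 i).

Definition col_scale (R : realType) (m n : nat) (v : 'rV[R]_n)
    (A : 'M[R]_(m, n)) : 'M[R]_(m, n) :=
  \matrix_(i, j) (v 0 j * A i j / col_sums A 0 j).

(* [sinkhorn A u v k] is the k-th iterate A^(k); A^(0) is already row-scaled. *)
Fixpoint sinkhorn (R : realType) (m n : nat) (A : 'M[R]_(m, n))
    (u : 'rV[R]_m) (v : 'rV[R]_n) (k : nat) : 'M[R]_(m, n) :=
  if k is k'.+1 then
    if odd k then col_scale v (sinkhorn A u v k')
    else row_scale u (sinkhorn A u v k')
  else row_scale u A.

(* The index set is nonempty and the default value is one of the values of F, *)
(* so this is the minimum of F.                                               *)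
Definition min_ord (R : realType) (n : nat) (F : 'I_n.+1 -> R) : R :=
  \big[Num.min/F ord0]_(i < n.+1) F i.

Definition row_bound (R : realType) (m n : nat) (rho : R)
    (M : 'M[R]_(m.+1, n)) (v : 'rV[R]_n) : R :=
  min_ord (fun i => \sum_j v 0 j * (M i j <= rho)%R%:R).

Definition col_bound (R : realType) (m n : nat) (rho : R)
    (M : 'M[R]_(m, n.+1)) (u : 'rV[R]_m) : R :=
  min_ord (fun j => \sum_i u 0 i * (M i j <= rho)%R%:R).

Definition well_bounded (R : realType) (m n : nat) (rho kappa : R)
    (M : 'M[R]_(m.+1, n.+1)) (u : 'rV[R]_m.+1) (v : 'rV[R]_n.+1) : Prop :=
  1 + kappa <= row_bound rho M v + col_bound rho M u.

(* Main.v *)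
Require Import Defs.
From HB Require Import structures.
From mathcomp Require Import all_boot all_order all_algebra.
From mathcomp Require Import all_classical all_reals all_analysis.
From mathcomp Require Import ring lra.
Set Implicit Arguments.
Unset Strict Implicit.
Unset Printing Implicit Defensive.
Import Order.TTheory GRing.Theory Num.Theory.
Local Open Scope ring_scope.

(* Write the iterates as [u_i x_i K_ij y_j v_j] with [K = exp (- eta C)],
   where the row and column steps replace [x] and [y] by the inverses of
   weighted sums. If [d] is the ratio of two successive [y]'s, the column
   sums are [v_j / d_j], so the error is at most [max d / min d - 1]. Each
   half step replaces [d] by the inverse of an average with weights [x_i
   K_ij y_j]; as one of the two bounds in the well-boundedness is at least
   [(1 + kappa) / 2], in one of the two half steps any two averages share a
   mass [kappa p], where [p] bounds [x_i K_ij y_j] from below on the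
   entries with [eta C_ij <= rho], and the oscillation contracts by [1 -
   kappa p]. To bound [p], compare with a nearly balanced scaling: since
   [K] is positive the iterates eventually become nearly balanced (at an
   uncontrolled rate), and for those [p] is at least a constant times [exp
   (- 3 rho) kappa^2] by well-boundedness. The Hilbert distance between the
   sequence and its shift does not increase, so all iterates lose only a
   further factor [exp (- 3 rho) kappa^3] in [p]. *)

(** * Multiplicative oscillation and averages *)

Definition osc (R : realType) (J : Type) (d : J -> R) (omega : R) : Prop :=
  forall j j', d j <= (1 + omega) * d j'.

(** The shared mass [m] cancels in the difference of the two averages. What remains of [p] meets
    values at most [1 + omega] times the minimum of [d], what remains of [q] meets values at least
    that minimum, and the minimum is at most the [q]-average. *)
Lemma osc_average (R : realType) (J : finType) (j0 : J) (p q m d : J -> R)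
    (omega delta : R) :
  (forall j, 0 < d j) -> 0 <= omega -> osc d omega ->
  (forall j, 0 <= q j) -> (forall j, m j <= p j) -> (forall j, m j <= q j) ->
  \sum_j p j = 1 -> \sum_j q j = 1 -> delta <= \sum_j m j ->
  \sum_j p j * d j <= (1 + (1 - delta) * omega) * \sum_j q j * d j.
Proof.
move=> d0 om0 dosc q0 mp mq sp sq dm.
have [jm _ jmP] := @arg_minP _ _ _ j0 predT d isT.
set s := \sum_j m j in dm.
have lo_q : d jm <= \sum_j q j * d j.
  rewrite -[leLHS]mul1r -sq mulr_suml; apply: ler_sum => j _.
  by rewrite ler_wpM2l // jmP.
have hp : \sum_j (p j - m j) * d j <= (1 - s) * ((1 + omega) * d jm).
  rewrite -{1}sp -sumrB mulr_suml; apply: ler_sum => j _.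
  by rewrite ler_wpM2l ?subr_ge0 ?mp //; exact: dosc.
have hq : (1 - s) * d jm <= \sum_j (q j - m j) * d j.
  rewrite -sq -sumrB mulr_suml; apply: ler_sum => j _.
  by rewrite ler_wpM2l ?subr_ge0 ?mq // jmP.
have s1 : s <= 1 by rewrite -sp; apply: ler_sum.
have diff : \sum_j (p j - m j) * d j - \sum_j (q j - m j) * d j =
    \sum_j p j * d j - \sum_j q j * d j.
  by rewrite -!sumrB; apply: eq_bigr => j _; ring.
have h1 : (1 - s) * (omega * d jm) <= (1 - delta) * (omega * d jm).
  by apply: ler_wpM2r; [rewrite mulr_ge0 // ltW | lra].
have h2 : (1 - delta) * (omega * d jm) <=
    (1 - delta) * (omega * \sum_j q j * d j).
  by apply: ler_wpM2l; [lra | rewrite ler_wpM2l].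
by rewrite mulrDl mul1r; lra.
Qed.

(** Inclusion-exclusion in a space of total mass 1. *)
Lemma overlap (R : realType) (J : finType) (w : J -> R) (A B : pred J)
    (a kappa : R) :
  (forall j, 0 < w j) -> \sum_j w j = 1 ->
  a <= \sum_j w j * (A j)%:R -> a <= \sum_j w j * (B j)%:R ->
  1 + kappa <= a + a -> kappa <= \sum_j w j * (A j && B j)%:R.
Proof.
move=> w0 w1 aA aB ka.
have : \sum_j w j * (A j)%:R + \sum_j w j * (B j)%:R <=
    \sum_j w j + \sum_j w j * (A j && B j)%:R.
  rewrite -!big_split /=; apply: ler_sum => j _.
  by have := w0 j; case: (A j); case: (B j) => /=; lra.
rewrite w1; lra.
Qed.

(** * Half steps of the scaling iteration *)

Section Rescale.
Variables (R : realType) (I J : finType) (j0 : J).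
Variables (K : I -> J -> R) (w : J -> R).
Hypotheses (K0 : forall i j, 0 < K i j) (w0 : forall j, 0 < w j).

(** The factor that normalises the rows of [K i j * w j * y j]. The column half step is the same map
    for the transposed kernel. *)
Definition rescale (y : J -> R) (i : I) : R := (\sum_j K i j * w j * y j)^-1.

Lemma sum_gt0 (F : J -> R) : (forall j, 0 < F j) -> 0 < \sum_j F j.
Proof.
move=> F0; rewrite (bigD1 j0) //= ltr_pwDl // sumr_ge0 // => j _.
exact: ltW.
Qed.

Lemma rescale_gt0 y i : (forall j, 0 < y j) -> 0 < rescale y i.
Proof. by move=> y0; rewrite invr_gt0 sum_gt0 // => j; rewrite !mulr_gt0. Qed.

Lemma rescale_sum y i : (forall j, 0 < y j) ->
  \sum_j rescale y i * K i j * w j * y j = 1.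
Proof.
move=> y0; under eq_bigr do rewrite -!mulrA.
rewrite -mulr_sumr; under eq_bigr do rewrite mulrA.
by rewrite mulVf // -invr_eq0 gt_eqF // rescale_gt0.
Qed.

(** By [rescale_sum] the weights on the right sum to 1, so the inverse change of the scaling factor
    is an average of the ratios [y' / y]. *)
Lemma rescale_ratio y y' i : (forall j, 0 < y j) -> (forall j, 0 < y' j) ->
  rescale y i / rescale y' i =
    \sum_j rescale y i * K i j * w j * y j * (y' j / y j).
Proof.
move=> y0 y'0; rewrite [rescale y' i]/rescale invrK mulr_sumr.
by apply: eq_bigr => j _; field; rewrite gt_eqF.
Qed.

(** For any two rows, the weights of [rescale_ratio] both dominate [p * w j] on the columns common
    to [N i] and [N i']. This is a shared mass of at least [kappa * p], to which [osc_average]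
    applies. *)
Lemma rescale_osc (N : I -> J -> bool) y y' (omega p kappa : R) :
  (forall j, 0 < y j) -> (forall j, 0 < y' j) -> 0 <= omega -> 0 <= p ->
  osc (fun j => y' j / y j) omega ->
  (forall i j, N i j -> p <= rescale y i * K i j * y j) ->
  (forall i i', kappa <= \sum_j w j * (N i j && N i' j)%:R) ->
  osc (fun i => rescale y' i / rescale y i) ((1 - kappa * p) * omega).
Proof.
move=> y0 y'0 om0 p0 yosc Np ov i i'.
have x0 := rescale_gt0 _ y0; have x'0 := rescale_gt0 _ y'0.
have wt0 k j : 0 <= rescale y k * K k j * w j * y j.
  by rewrite !mulr_ge0 // ltW.
(* The averages are the inverses of the ratios in the goal, so [i] and [i'] trade places. *)
have key : rescale y i' / rescale y' i' <=
    (1 + (1 - kappa * p) * omega) * (rescale y i / rescale y' i).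
  rewrite !rescale_ratio //.
  apply: (osc_average j0 (m := fun j => p * (w j * (N i j && N i' j)%:R))) => //.
  - by move=> j; rewrite divr_gt0.
  - move=> j; case: (boolP (N i j)) => [_|_] /=; last by rewrite !mulr0.
    case: (boolP (N i' j)) => [Nij'|_] /=; last by rewrite !mulr0.
    rewrite mulr1 mulrAC ler_wpM2r ?Np // ltW //.
  - move=> j; case: (boolP (N i j)) => [Nij|_] /=; last by rewrite !mulr0.
    case: (N i' j) => /=; last by rewrite !mulr0.
    rewrite mulr1 mulrAC ler_wpM2r ?Np // ltW //.
  - exact: rescale_sum.
  - exact: rescale_sum.
  - by rewrite -mulr_sumr mulrC ler_wpM2l.
rewrite /=; set A := 1 + _ in key *.
rewrite -(invf_div (rescale y i)) -(invf_div (rescale y i')).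
rewrite -[X in X <= _]mul1r ler_pdivrMr ?divr_gt0 // mulrAC.
by rewrite ler_pdivlMr ?divr_gt0 // mul1r.
Qed.

(** The case of empty [N] and [p = 0]. Since [ln (1 + omega)] bounds the Hilbert distance of [y] and
    [y'], a half step does not increase that distance. *)
Lemma rescale_osc_nonexpansive y y' (omega : R) :
  (forall j, 0 < y j) -> (forall j, 0 < y' j) -> 0 <= omega ->
  osc (fun j => y' j / y j) omega ->
  osc (fun i => rescale y' i / rescale y i) omega.
Proof.
move=> y0 y'0 om0 yosc.
have := @rescale_osc (fun _ _ => false) y y' omega 0 0 y0 y'0 om0 (lexx 0) yosc.
rewrite mul0r subr0 mul1r; apply => // i i'.
by rewrite big1 // => j _; rewrite mulr0.
Qed.

(** Transfers lower bounds from a reference [yh] to [y]: the ratio of the row factors is an average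
    of [y / yh], hence at most [1 + omega] times its value at [j]. *)
Lemma rescale_lower y yh (omega : R) i j :
  (forall j, 0 < y j) -> (forall j, 0 < yh j) ->
  osc (fun j => y j / yh j) omega ->
  rescale yh i * yh j <= (1 + omega) * (rescale y i * y j).
Proof.
move=> y0 yh0 yosc.
have x0 := rescale_gt0 i y0; have xh0 := rescale_gt0 i yh0.
have : rescale yh i / rescale y i <= (1 + omega) * (y j / yh j).
  rewrite rescale_ratio // -[leRHS]mul1r -{1}(rescale_sum i yh0) mulr_suml.
  apply: ler_sum => j' _; apply: ler_wpM2l; last exact: yosc.
  by rewrite !mulr_ge0 // ltW.
have -> : (1 + omega) * (y j / yh j) = (1 + omega) * y j / yh j by rewrite mulrA.
rewrite ler_pdivrMr // mulrAC ler_pdivlMr // => /le_trans; apply.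
by rewrite -mulrA [y j * _]mulrC.
Qed.

End Rescale.

(** * Crude bounds for kernels with entries at most 1 *)

Section Crude.
Variables (R : realType) (I J : finType) (j0 : J).
Variables (K : I -> J -> R) (w : J -> R).
Hypotheses (K0 : forall i j, 0 < K i j) (w0 : forall j, 0 < w j).
Hypotheses (K1 : forall i j, K i j <= 1) (w1 : \sum_j w j = 1).

Lemma rescale_ge y i : (forall j, 0 < y j) -> (\sum_j w j * y j)^-1 <= rescale K w y i.
Proof.
move=> y0; rewrite lef_pV2 ?posrE ?sum_gt0 // => [|j|j]; rewrite ?mulr_gt0 //.
apply: ler_sum => j _; apply: ler_wpM2r; first exact: ltW.
by rewrite ler_piMl // ltW.
Qed.

Lemma rescale_lower_osc y (omega : R) i j : (forall j, 0 < y j) -> osc y omega ->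
  1 <= (1 + omega) * (rescale K w y i * y j).
Proof.
move=> y0 yosc; have S0 : 0 < \sum_j w j * y j.
  by apply: sum_gt0 => // k; rewrite mulr_gt0.
have SH := rescale_ge i y0.
have Sy : \sum_j w j * y j <= (1 + omega) * y j.
  rewrite -[leRHS]mul1r -{1}w1 mulr_suml; apply: ler_sum => k _.
  by apply: ler_wpM2l; [rewrite ltW | exact: yosc].
rewrite [rescale K w y i * _]mulrC mulrA -[leLHS](@mulfV _ (\sum_j w j * y j)) ?gt_eqF //.
by apply: ler_pM => //; rewrite ltW ?invr_gt0.
Qed.

(** As [K] lies between [k0] and 1, the sums of any two rows agree up to the factor [k0], whatever
    [y] is. *)
Lemma rescale_osc_crude y (k0 : R) : (forall j, 0 < y j) -> 0 < k0 ->
  (forall i j, k0 <= K i j) -> osc (rescale K w y) (k0^-1 - 1).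
Proof.
move=> y0 k00 Kk i i'; rewrite addrC subrK /rescale -invfM.
rewrite lef_pV2 ?posrE ?mulr_gt0 ?sum_gt0 // => [|j|j]; rewrite ?mulr_gt0 //.
rewrite mulr_sumr; apply: ler_sum => j _; rewrite !mulrA.
do 2 (apply: ler_wpM2r; first exact: ltW).
by rewrite (le_trans _ (Kk i j)) // ler_piMr ?K1 // ltW.
Qed.

End Crude.

Lemma geometric_le (R : realType) (delta w0 omega : R) t :
  delta <= 1 -> 0 < w0 -> 0 < omega -> ln (w0 / omega) <= delta * t%:R ->
  (1 - delta) ^+ t * w0 <= omega.
Proof.
move=> d1 w00 om0 lnle; have W0 : 0 < w0 / omega by rewrite divr_gt0.
have : (1 - delta) ^+ t <= expR (- (delta * t%:R)).
  rewrite -mulNr expRM_natr lerXn2r ?nnegrE ?subr_ge0 ?expR_ge0 //.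
  exact: expR_ge1Dx.
move=> /le_trans h; rewrite -ler_pdivlMr //; apply: h.
by rewrite -invf_div -(lnK W0) -expRN ler_expR lerN2.
Qed.

(** * The full iteration, seen on the column factors alone *)

Section Iteration.
Variables (R : realType) (I J : finType) (i0 : I) (j0 : J).
Variables (K : I -> J -> R) (u : I -> R) (v : J -> R).
Hypotheses (K0 : forall i j, 0 < K i j).
Hypotheses (u0 : forall i, 0 < u i) (v0 : forall j, 0 < v j).
Hypotheses (u1 : \sum_i u i = 1) (v1 : \sum_j v j = 1).

Definition sk_step (y : J -> R) : J -> R :=
  rescale (fun j i => K i j) u (rescale K v y).
Definition gap (y : J -> R) (j : J) : R := sk_step y j / y j.

Lemma sk_step_gt0 y j : (forall j, 0 < y j) -> 0 < sk_step y j.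
Proof.
by move=> y0; apply: (rescale_gt0 i0) => // i; apply: (rescale_gt0 j0).
Qed.

Lemma iter_sk_step_gt0 t y j : (forall j, 0 < y j) -> 0 < iter t sk_step y j.
Proof.
by move=> y0; elim: t j => [|t IH] j //=; apply: sk_step_gt0.
Qed.

Lemma gap_invE y j :
  (gap y j)^-1 = y j * \sum_i K i j * u i * rescale K v y i.
Proof. by rewrite /gap invf_div /sk_step /rescale invrK. Qed.

(** The inverse gaps are the column sums relative to [v]. Their [v]-average is 1 because the rows
    already have total mass 1, so each of them is within the factor [1 + omega] of 1. *)
Lemma gap_lower_upper y omega j : (forall j, 0 < y j) -> 0 <= omega ->
  osc (gap y) omega -> 1 - omega <= (gap y j)^-1 <= 1 + omega.
Proof.
move=> y0 om0 gosc; have x0 i : 0 < rescale K v y i by apply: rescale_gt0.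
have g0 k : 0 < gap y k by rewrite divr_gt0 // sk_step_gt0.
have sg : \sum_k v k * (gap y k)^-1 = 1.
  under eq_bigr do rewrite gap_invE mulrA mulr_sumr.
  rewrite exchange_big /= -u1; apply: eq_bigr => i _.
  rewrite -[RHS]mulr1 -(rescale_sum j0 K0 v0 i y0) mulr_sumr.
  by apply: eq_bigr => k _; ring.
have gg k k' : (gap y k)^-1 <= (1 + omega) * (gap y k')^-1.
  rewrite -[leLHS]mul1r ler_pdivrMr // mulrAC ler_pdivlMr // mul1r.
  exact: gosc.
have up k : (gap y k)^-1 <= 1 + omega.
  have -> : 1 + omega = \sum_k' v k' * ((1 + omega) * (gap y k')^-1).
    under eq_bigr do rewrite mulrCA.
    by rewrite -mulr_sumr sg mulr1.
  rewrite -[leLHS]mul1r -{1}v1 mulr_suml; apply: ler_sum => k' _.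
  by apply: ler_wpM2l; [rewrite ltW | exact: gg].
rewrite up andbT.
have lo : 1 <= (1 + omega) * (gap y j)^-1.
  have -> : (1 + omega) * (gap y j)^-1 = \sum_k v k * ((1 + omega) * (gap y j)^-1).
    by rewrite -mulr_suml v1 mul1r.
  rewrite -[leLHS]sg.
  by apply: ler_sum => k _; apply: ler_wpM2l; [rewrite ltW | exact: gg].
have := up j; have : omega * (gap y j)^-1 <= omega * (1 + omega) by rewrite ler_wpM2l.
move: lo; set g := (gap y j)^-1; nra.
Qed.

(** The larger of [a] and [b] decides which half step contracts: the row step through the first
    density bound, or the column step through the second, whose weights involve the updated
    [sk_step y]. The other half step is only nonexpansive. *)
Lemma gap_contract (N : I -> J -> bool) (a b kappa p : R) y omega :
  (forall i, a <= \sum_j v j * (N i j)%:R) ->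
  (forall j, b <= \sum_i u i * (N i j)%:R) -> 1 + kappa <= a + b ->
  0 <= p -> kappa * p <= 1 -> (forall j, 0 < y j) -> 0 <= omega ->
  (forall i j, N i j -> p <= rescale K v y i * K i j * y j) ->
  (forall i j, N i j -> p <= rescale K v y i * K i j * sk_step y j) ->
  osc (gap y) omega -> osc (gap (sk_step y)) ((1 - kappa * p) * omega).
Proof.
move=> Na Nb ab p0 kp y0 om0 NP NQ gosc.
have y'0 j : 0 < sk_step y j by apply: sk_step_gt0.
have x0 z i : (forall j, 0 < z j) -> 0 < rescale K v z i.
  by move=> z0; apply: (rescale_gt0 j0).
have om'0 : 0 <= (1 - kappa * p) * omega by rewrite mulr_ge0 // subr_ge0.
have [aa|bb] : 1 + kappa <= a + a \/ 1 + kappa <= b + b.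
- by case: (lerP b a) => ?; [left|right]; lra.
- apply: (rescale_osc_nonexpansive i0) => //; try by move=> i; apply: x0.
  apply: (rescale_osc j0 K0 v0 y0 y'0 om0 p0 gosc NP) => i i'.
  exact: overlap v0 v1 (Na i) (Na i') aa.
- apply: (@rescale_osc R J I i0 (fun j i => K i j) u (fun j i => K0 i j) u0
    (fun j i => N i j)) => //; try by move=> i; apply: x0.
  + exact: (rescale_osc_nonexpansive j0).
  + by move=> j i /NQ; rewrite mulrAC [_ * rescale _ _ _ _]mulrC mulrA mulrAC.
  + by move=> j j'; exact: overlap u0 u1 (Nb j) (Nb j') bb.
Qed.

Lemma gap_contract_iter (N : I -> J -> bool) (a b kappa p : R) y omega t :
  (forall i, a <= \sum_j v j * (N i j)%:R) ->
  (forall j, b <= \sum_i u i * (N i j)%:R) -> 1 + kappa <= a + b ->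
  0 <= p -> kappa * p <= 1 -> (forall j, 0 < y j) -> 0 <= omega ->
  (forall t i j, N i j ->
    p <= rescale K v (iter t sk_step y) i * K i j * iter t sk_step y j) ->
  (forall t i j, N i j ->
    p <= rescale K v (iter t sk_step y) i * K i j * iter t.+1 sk_step y j) ->
  osc (gap y) omega ->
  osc (gap (iter t sk_step y)) ((1 - kappa * p) ^+ t * omega).
Proof.
move=> Na Nb ab p0 kp y0 om0 NP NQ gosc.
elim: t => [|t IH] /=; first by rewrite expr0 mul1r.
rewrite exprS -mulrA; apply: (gap_contract Na Nb) => //.
- by move=> j; apply: iter_sk_step_gt0.
- by rewrite mulr_ge0 // exprn_ge0 // subr_ge0.
- exact: NP.
- exact: NQ.
Qed.

Lemma ratio_osc_iter t y y' omega :
  (forall j, 0 < y j) -> (forall j, 0 < y' j) -> 0 <= omega ->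
  osc (fun j => y' j / y j) omega ->
  osc (fun j => iter t sk_step y' j / iter t sk_step y j) omega.
Proof.
move=> y0 y'0 om0 yosc; elim: t => [|t IH] //=.
have [z0 z'0] : (forall j, 0 < iter t sk_step y j) /\
    (forall j, 0 < iter t sk_step y' j).
  by split=> j; apply: iter_sk_step_gt0.
apply: (rescale_osc_nonexpansive i0) => //; try by move=> i; apply: (rescale_gt0 j0).
exact: (rescale_osc_nonexpansive j0).
Qed.

(** * Eventual near balance, at a rate depending on the smallest entry *)

Section UpperBoundOne.
Hypothesis (K1 : forall i j, K i j <= 1).

(** [gap_contract_iter] with every entry in [N] and [a = b = kappa = 1]. With [k0] the smallest
    entry, [K] contributes one factor [k0] to the density and the oscillation of the factors, at
    most [k0^-1 - 1], contributes another; hence [p = k0 * k0]. *)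
Lemma sk_step_gap_small (omega : R) : 0 < omega ->
  exists T, forall t, osc (gap (iter (T + t) sk_step (fun=> 1))) omega.
Proof.
move=> om0.
have [k0 k00 kK] : exists2 k0 : R, 0 < k0 & forall i j, k0 <= K i j.
  exists (\big[Num.min/1]_(ij : I * J) K ij.1 ij.2).
    by apply/bigmin_gtP; split=> // -[i j] _ /=.
  by move=> i j; apply: (bigmin_le 1 (i, j)).
have k01 : k0 <= 1 by apply: le_trans (kK i0 j0) (K1 _ _).
have kk0 : 0 < k0 * k0 by rewrite mulr_gt0.
have kk1 : k0 * k0 <= 1 by rewrite mulr_ile1 // ltW.
have ki0 : 0 <= k0^-1 - 1 by rewrite subr_ge0 invf_ge1.
have z0 t j : 0 < iter t sk_step (fun=> 1) j by apply: iter_sk_step_gt0.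
have x0 t i : 0 < rescale K v (iter t sk_step (fun=> 1)) i.
  by apply: (rescale_gt0 j0).
have xosc t : osc (rescale K v (iter t sk_step (fun=> 1))) (k0^-1 - 1).
  exact: (rescale_osc_crude j0).
have sosc t : osc (iter t.+1 sk_step (fun=> 1)) (k0^-1 - 1).
  exact: (rescale_osc_crude i0 (fun j i => K0 i j) u0 (fun j i => K1 i j)
    (x0 t) k00 (fun j i => kK i j)).
have zosc t : osc (iter t sk_step (fun=> 1)) (k0^-1 - 1).
  by case: t => [|t]; [move=> j j' /=; rewrite addrC subrK mulr1 invf_ge1 | exact: sosc].
have kp i j (w : R) : 1 <= (1 + (k0^-1 - 1)) * w -> k0 * k0 <= K i j * w.
  rewrite addrC subrK mulrC ler_pdivlMr // mul1r => kw.
  by rewrite ler_pM // ltW.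
have sum1 (H : finType) (w : H -> R) : \sum_h w h = 1 -> 1 <= \sum_h w h * true%:R.
  by move=> w1; rewrite -{1}w1; apply: ler_sum => h _; rewrite mulr1.
have step T : osc (gap (iter T sk_step (fun=> 1)))
    ((1 - 1 * (k0 * k0)) ^+ T * (k0^-1 - 1)).
  apply: (gap_contract_iter (N := fun _ _ => true) (a := 1) (b := 1)) => //.
  - by move=> i; apply: sum1.
  - by move=> j; apply: sum1.
  - exact: ltW.
  - by rewrite mul1r.
  - move=> t i j _; rewrite [_ * K i j]mulrC -mulrA; apply: kp.
    exact: (rescale_lower_osc j0).
  - move=> t i j _; rewrite [_ * K i j]mulrC -mulrA; apply: kp.
    rewrite [rescale _ _ _ _ * _]mulrC.
    exact: (rescale_lower_osc i0 (fun j i => K0 i j) u0 (fun j i => K1 i j) u1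
      j i (x0 t) (xosc t)).
  - by move=> j j'; have := sosc 0%N j j'; rewrite /gap !divr1.
have [T small] : exists T, forall t,
    (1 - 1 * (k0 * k0)) ^+ (T + t) * (k0^-1 - 1) <= omega.
  set T := (Num.truncn ((k0 * k0)^-1 * ln (k0^-1 / omega))).+1.
  exists T => t; apply: (@le_trans _ _ ((1 - 1 * (k0 * k0)) ^+ (T + t) * k0^-1)).
    by rewrite ler_wpM2l ?exprn_ge0 ?mul1r ?subr_ge0 // gerBl.
  apply: geometric_le; rewrite ?mul1r ?invr_gt0 // -ler_pdivrMl //.
  apply: (le_trans (ltW (truncnS_gt _))).
  by rewrite ler_nat leq_addr.
exists T => t j j'; have /le_trans := step (T + t)%N j j'; apply.
rewrite ler_wpM2r ?lerD2l //.
by rewrite ltW // divr_gt0 // sk_step_gt0.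
Qed.

(** * Explicit bounds from well-boundedness *)

Section WellBounded.
Variables (N : I -> J -> bool) (a b kappa theta : R).
Hypotheses (Na : forall i, a <= \sum_j v j * (N i j)%:R).
Hypotheses (Nb : forall j, b <= \sum_i u i * (N i j)%:R).
Hypotheses (ab : 1 + kappa <= a + b) (kappa01 : 0 < kappa <= 1).
Hypotheses (theta01 : 0 < theta <= 1) (NK : forall i j, N i j -> theta <= K i j).

Lemma wb_le1_row : a <= 1.
Proof.
rewrite -v1; apply: (le_trans (Na i0)); apply: ler_sum => j _.
by rewrite ler_piMr ?(ltW (v0 j)) // lern1 leq_b1.
Qed.

Lemma wb_le1_col : b <= 1.
Proof.
rewrite -u1; apply: (le_trans (Nb j0)); apply: ler_sum => i _.
by rewrite ler_piMr ?(ltW (u0 i)) // lern1 leq_b1.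
Qed.

Lemma wb_row_ge : kappa <= a.
Proof. move: ab wb_le1_col; lra. Qed.

Lemma wb_col_ge : kappa <= b.
Proof. move: ab wb_le1_row; lra. Qed.

(* Let [x] be the row scaling of [y] and [S] the total mass of [y]. If some  *)
(* [x i] is huge, then [y] has little mass on the columns of [N i], so the   *)
(* rows with [S * x <= L] put almost all of their mass on the complement of  *)
(* [N i], which has column mass at most [1 - a < b]. Hence every column sees *)
(* mass [kappa / 2] of the other rows, which bounds [y j] by less than [S].  *)
Lemma rescale_mass_le y i : (forall j, 0 < y j) -> osc (gap y) (kappa / 4) ->
  rescale K v y i * \sum_j v j * y j <= 24 / (theta ^+ 2 * kappa ^+ 2).
Proof.
move=> y0 gosc; rewrite leNgt; apply/negP => big.
have [k0 k1] := andP kappa01; have [th0 th1] := andP theta01.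
set S := \sum_j v j * y j in big.
have S0 : 0 < S by apply: (sum_gt0 j0) => j; rewrite mulr_gt0.
have x0 k : 0 < rescale K v y k by apply: (rescale_gt0 j0).
have k40 : 0 <= kappa / 4 by lra.
have gup j : (gap y j)^-1 <= 1 + kappa / 4.
  by have /andP[] := gap_lower_upper j y0 k40 gosc.
(* The rows with [S * x <= L], for [L = 3 / (theta * kappa)]. Together with the bound [light], they
   put at most [kappa / 8] of their mass on [N i]. *)
pose B k := rescale K v y k * S <= 3 / (theta * kappa).
have tk : 0 < theta * kappa by rewrite mulr_gt0.
have light : \sum_j v j * y j * (N i j)%:R <= theta * kappa ^+ 2 * S / 24.
  have : theta * (\sum_j v j * y j * (N i j)%:R) <= (rescale K v y i)^-1.
    rewrite /rescale invrK mulr_sumr; apply: ler_sum => j _.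
    rewrite -[leRHS]mulrA; case: (boolP (N i j)) => [/NK h|_].
      by rewrite mulr1 ler_wpM2r // mulr_ge0 // ltW.
    by rewrite !mulr0 !mulr_ge0 // ltW.
  have : (rescale K v y i)^-1 <= theta ^+ 2 * kappa ^+ 2 * S / 24.
    rewrite -[leLHS]mul1r ler_pdivrMr //.
    move: big; rewrite ltr_pdivrMr ?mulr_gt0 ?exprn_gt0 // => /ltW; nra.
  move=> h1 h2; rewrite -(ler_pM2l th0); apply: (le_trans h2).
  by apply: (le_trans h1); rewrite le_eqVlt; apply/orP; left; apply/eqP; field.
have uB : \sum_(k | B k) u k <= 1 - a + kappa / 2.
  have rowB k : B k -> 1 - kappa / 8 <=
      \sum_j rescale K v y k * K k j * v j * y j * (~~ N i j)%:R.
    move=> Bk; have := rescale_sum j0 K0 v0 k y0.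
    have -> : \sum_j rescale K v y k * K k j * v j * y j =
      \sum_j rescale K v y k * K k j * v j * y j * (~~ N i j)%:R +
      \sum_j rescale K v y k * K k j * v j * y j * (N i j)%:R.
      rewrite -big_split /=; apply: eq_bigr => j _.
      by case: (N i j) => /=; rewrite mulr1 mulr0 ?addr0 ?add0r.
    (* Here [K <= 1] is used. *)
    have : \sum_j rescale K v y k * K k j * v j * y j * (N i j)%:R <=
        rescale K v y k * (\sum_j v j * y j * (N i j)%:R).
      rewrite mulr_sumr; apply: ler_sum => j _.
      rewrite -!mulrA; apply: ler_wpM2l; first exact: ltW.
      by rewrite ler_piMl // !mulr_ge0 // ltW.
    have : rescale K v y k * (\sum_j v j * y j * (N i j)%:R) <= kappa / 8.
      apply: (@le_trans _ _ (rescale K v y k * (theta * kappa ^+ 2 * S / 24))).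
        by apply: ler_wpM2l; first exact: ltW.
      move: Bk; rewrite /B ler_pdivlMr //; nra.
    lra.
  (* The rows of [B] send at least [1 - kappa / 8] of their mass off [N i], where the column sums
     total at most [(1 + kappa / 4) * (1 - a)]. *)
  have h : (1 - kappa / 8) * (\sum_(k | B k) u k) <= (1 + kappa / 4) * (1 - a).
    apply: (@le_trans _ _ (\sum_j v j * (gap y j)^-1 * (~~ N i j)%:R)).
      apply: (@le_trans _ _ (\sum_k u k *
          \sum_j rescale K v y k * K k j * v j * y j * (~~ N i j)%:R)).
        rewrite [leRHS](bigID B) /= -[leLHS]addr0; apply: lerD.
          rewrite mulr_sumr; apply: ler_sum => k Bk; rewrite mulrC.
          by apply: ler_wpM2l; [exact: ltW | exact: rowB].
        apply: sumr_ge0 => k _; apply: mulr_ge0; first exact: ltW.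
        apply: sumr_ge0 => j _.
        by rewrite !mulr_ge0 // ltW.
      under eq_bigr do rewrite mulr_sumr.
      rewrite exchange_big /=; apply: ler_sum => j _.
      rewrite gap_invE mulrA mulr_sumr mulr_suml; apply: ler_sum => k _.
      by rewrite le_eqVlt; apply/orP; left; apply/eqP; ring.
    have -> : (1 + kappa / 4) * (1 - a) =
        (1 + kappa / 4) * (\sum_j v j - a) by rewrite v1.
    apply: (@le_trans _ _ ((1 + kappa / 4) * \sum_j v j * (~~ N i j)%:R)).
      rewrite mulr_sumr; apply: ler_sum => j _.
      rewrite mulrA; apply: ler_wpM2r => //.
      by rewrite mulrC; apply: ler_wpM2r; [exact: ltW | exact: gup].
    apply: ler_wpM2l; first lra.
    rewrite lerBrDr -lerBrDl; apply: (le_trans (Na i)).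
    rewrite -sumrB; apply: ler_sum => j _.
    by case: (N i j) => /=; lra.
  have uB1 : \sum_(k | B k) u k <= 1.
    rewrite -u1 [leRHS](bigID B) /= lerDl sumr_ge0 // => k _; exact: ltW.
  have := wb_row_ge; have := wb_le1_row; nra.
(* Rows of [N] outside [B] have mass at least [b - (1 - a + kappa / 2) >= kappa / 2], and there
   [K * x] is at least [3 / (kappa * S)]. So the column sum divided by [y j] is at least
   [3 / (2 * S)], while the column sum itself is at most [5 / 4]. *)
have heavy j : y j <= 5 / 6 * S.
  have : kappa / 2 <= \sum_k u k * (N k j && ~~ B k)%:R.
    have : \sum_k u k * (N k j)%:R <=
        \sum_k u k * (N k j && ~~ B k)%:R + \sum_(k | B k) u k.
      rewrite [\sum_(k | B k) _]big_mkcond -big_split /=; apply: ler_sum => k _.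
      by have := u0 k; case: (N k j); case: (B k) => /=; lra.
    move: ab (Nb j) uB; lra.
  have : 3 / (kappa * S) * \sum_k u k * (N k j && ~~ B k)%:R <=
      \sum_k K k j * u k * rescale K v y k.
    rewrite mulr_sumr; apply: ler_sum => k _.
    case: (boolP (N k j)) => [/NK Nkj|_] /=; last first.
      by rewrite !mulr0 !mulr_ge0 // ltW.
    case: (boolP (B k)) => [_|nB] /=; first by rewrite !mulr0 !mulr_ge0 // ltW.
    rewrite mulr1 [leRHS]mulrAC; apply: ler_wpM2r; first exact: ltW.
    move: nB; rewrite /B -ltNge => /ltW; rewrite ler_pdivrMr // => nB.
    rewrite ler_pdivrMr ?mulr_gt0 //; apply: (le_trans nB).
    have -> : K k j * rescale K v y k * (kappa * S) =
      rescale K v y k * S * (K k j * kappa) by ring.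
    by rewrite ler_wpM2l ?ler_wpM2r // ?mulr_ge0 // ltW.
  set W := \sum_k _; set Z := \sum_k _ => hZ hW.
  have := gup j; rewrite gap_invE -/Z => hup.
  have hZ' : 3 / 2 / S <= Z.
    apply: le_trans hZ; rewrite ler_pdivrMr //.
    have -> : 3 / (kappa * S) * W * S = 3 * W / kappa by field; rewrite !gt_eqF.
    by rewrite ler_pdivlMr //; lra.
  have : y j * (3 / 2 / S) <= 5 / 4.
    apply: (@le_trans _ _ (y j * Z)); first by rewrite ler_wpM2l // ltW.
    by apply: (le_trans hup); lra.
  rewrite mulrA ler_pdivrMr //; lra.
(* [S] is the [v]-average of [y], which contradicts [heavy]. *)
have : S <= 5 / 6 * S.
  rewrite {1}/S -[leRHS]mul1r -{1}v1 mulr_suml; apply: ler_sum => j _.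
  by rewrite ler_wpM2l // ltW.
lra.
Qed.

(** Averaging [rescale_mass_le] over [u] bounds the total row factor, whose inverse is a lower bound
    for the next column factor. Going back to [y] costs an inverse gap, at least [3 / 4], which
    turns 24 into 32. *)
Lemma reference_mass_lower y j : (forall j, 0 < y j) ->
  osc (gap y) (kappa / 4) ->
  (\sum_j v j * y j) * (theta ^+ 2 * kappa ^+ 2 / 24) <= sk_step y j /\
  (\sum_j v j * y j) * (theta ^+ 2 * kappa ^+ 2 / 32) <= y j.
Proof.
move=> y0 gosc; have [k0 k1] := andP kappa01; have [th0 th1] := andP theta01.
set S := \sum_j v j * y j.
have S0 : 0 < S by apply: (sum_gt0 j0) => k; rewrite mulr_gt0.
have x0 k : 0 < rescale K v y k by apply: (rescale_gt0 j0).
set X := \sum_i u i * rescale K v y i.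
have X0 : 0 < X by apply: (sum_gt0 i0) => k; rewrite mulr_gt0.
have tk : 0 < theta ^+ 2 * kappa ^+ 2 by rewrite mulr_gt0 ?exprn_gt0.
have XS : X * S <= 24 / (theta ^+ 2 * kappa ^+ 2).
  rewrite mulr_suml -[leRHS]mul1r -{1}u1 mulr_suml; apply: ler_sum => k _.
  rewrite -mulrA; apply: ler_wpM2l; first exact: ltW.
  exact: rescale_mass_le.
have yge : X^-1 <= sk_step y j.
  exact: (rescale_ge i0 (fun j i => K0 i j) u0 (fun j i => K1 i j) j x0).
have gt : 3 / 4 <= (gap y j)^-1.
  by have /andP[+ _] := gap_lower_upper j y0 (ltac:(lra) : 0 <= kappa / 4) gosc; lra.
have low : S * (theta ^+ 2 * kappa ^+ 2 / 24) <= sk_step y j.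
  apply: le_trans yge; rewrite -[leRHS]mul1r ler_pdivlMr //.
  move: XS; rewrite ler_pdivlMr //; lra.
split=> //.
have -> : y j = (gap y j)^-1 * sk_step y j.
  by rewrite /gap invf_div mulfVK // gt_eqF // sk_step_gt0.
have : 3 / 4 * (S * (theta ^+ 2 * kappa ^+ 2 / 24)) <=
    (gap y j)^-1 * sk_step y j.
  by apply: ler_pM => //; apply: mulr_ge0; [exact: ltW | lra].
lra.
Qed.

(** Since [K <= 1], the row factor is at least the inverse of the mass of [y], which cancels the
    mass in [reference_mass_lower]. *)
Lemma reference_lower y i j : (forall j, 0 < y j) -> osc (gap y) (kappa / 4) ->
  theta ^+ 2 * kappa ^+ 2 / 32 <= rescale K v y i * sk_step y j /\
  theta ^+ 2 * kappa ^+ 2 / 32 <= rescale K v y i * y j.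
Proof.
move=> y0 gosc; have [k0 k1] := andP kappa01; have [th0 th1] := andP theta01.
have [ylow y'low] := reference_mass_lower j y0 gosc.
have := rescale_ge j0 K0 v0 K1 i y0; set S := \sum_j _ in ylow y'low * => xge.
have S0 : 0 < S by apply: (sum_gt0 j0) => k; rewrite mulr_gt0.
have tk : 0 < theta ^+ 2 * kappa ^+ 2 by rewrite mulr_gt0 ?exprn_gt0.
have bound c z : 0 <= c -> S * c <= z -> c <= rescale K v y i * z.
  move=> c0 cz; rewrite -[leLHS](mulKf (lt0r_neq0 S0)).
  by apply: ler_pM => //; [rewrite invr_ge0 ltW | apply: mulr_ge0; rewrite ?(ltW S0)].
split; last by apply: bound => //; lra.
by apply: (@le_trans _ _ (theta ^+ 2 * kappa ^+ 2 / 24)); [lra | apply: bound => //; lra].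
Qed.

(** Each column sees mass [kappa] of rows with [K >= theta], and row factors are at least [S^-1]; so
    a column sum of at most [5 / 4] gives [y j <= 5 / 4 * S / (theta * kappa)]. Dividing by the
    lower bound with 32 gives 40. *)
Lemma reference_spread y j j' : (forall j, 0 < y j) ->
  osc (gap y) (kappa / 4) -> y j <= 40 / (theta * kappa) ^+ 3 * y j'.
Proof.
move=> y0 gosc; have [k0 k1] := andP kappa01; have [th0 th1] := andP theta01.
have [_] := reference_mass_lower j' y0 gosc; set S := \sum_j v j * y j => low.
have S0 : 0 < S by apply: (sum_gt0 j0) => k; rewrite mulr_gt0.
have x0 k : 0 < rescale K v y k by apply: (rescale_gt0 j0).
have tk : 0 < theta * kappa by rewrite mulr_gt0.
have up : theta * kappa / S * y j <= 5 / 4.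
  have /andP[_] := gap_lower_upper j y0 (ltac:(lra) : 0 <= kappa / 4) gosc.
  rewrite gap_invE => gup; apply: (@le_trans _ _ (1 + kappa / 4)); last lra.
  apply: le_trans gup; rewrite mulrC; apply: ler_wpM2l; first exact: ltW.
  apply: (@le_trans _ _ (theta / S * \sum_i u i * (N i j)%:R)).
    rewrite mulrAC; apply: ler_wpM2l; first by rewrite divr_ge0 // ltW.
    exact: le_trans wb_col_ge (Nb j).
  rewrite mulr_sumr; apply: ler_sum => i _.
  case: (boolP (N i j)) => [/NK h|_]; last by rewrite !mulr0 !mulr_ge0 // ltW.
  rewrite mulr1 [leRHS]mulrAC; apply: ler_wpM2r; first exact: ltW.
  apply: ler_pM => //; rewrite ?invr_ge0 ?(ltW S0) ?(ltW th0) //.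
  exact: (rescale_ge j0).
have {}up : y j <= 5 / 4 * S / (theta * kappa).
  rewrite ler_pdivlMr // -ler_pdivrMr //.
  by move: up; rewrite [X in _ -> X <= _](_ : _ = theta * kappa / S * y j) //; ring.
apply: (le_trans up); rewrite ler_pdivrMr //.
have -> : 40 / (theta * kappa) ^+ 3 * y j' * (theta * kappa) =
   40 / (theta * kappa) ^+ 2 * y j' by field; rewrite !gt_eqF.
rewrite [leRHS]mulrAC ler_pdivlMr ?exprn_gt0 // exprMn; lra.
Qed.

(** The first row factors lie between 1 and [(theta * kappa)^-1], so the next column factors lie
    between [theta * kappa] and its inverse. *)
Lemma sk_gap_osc_start :
  osc (gap (fun=> 1)) ((theta * kappa) ^- 2 - 1).
Proof.
have [k0 k1] := andP kappa01; have [th0 th1] := andP theta01.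
have tk : 0 < theta * kappa by rewrite mulr_gt0.
have one0 (j : J) : 0 < (fun=> 1 : R) j by [].
have x0 i : 0 < rescale K v (fun=> 1) i by apply: (rescale_gt0 j0).
have xge i : 1 <= rescale K v (fun=> 1) i.
  have := rescale_ge j0 K0 v0 K1 i one0.
  by under eq_bigr do rewrite mulr1; rewrite v1 invr1.
have xle i : rescale K v (fun=> 1) i <= (theta * kappa)^-1.
  rewrite lef_pV2 ?posrE //; last first.
    by apply: (sum_gt0 j0) => j; rewrite !mulr_gt0.
  apply: (@le_trans _ _ (theta * \sum_j v j * (N i j)%:R)).
    by apply: ler_wpM2l; [exact: ltW | exact: le_trans wb_row_ge (Na i)].
  rewrite mulr_sumr; apply: ler_sum => j _; rewrite mulr1.
  case: (boolP (N i j)) => [/NK h|_]; last by rewrite !mulr0 mulr_ge0 // ltW.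
  by rewrite mulr1; apply: ler_wpM2r; first exact: ltW.
have sge j : theta * kappa <= sk_step (fun=> 1) j.
  rewrite -[leLHS]invrK lef_pV2 ?posrE ?invr_gt0 //; last first.
    by apply: (sum_gt0 i0) => i; rewrite !mulr_gt0.
  have -> : (theta * kappa)^-1 = \sum_i u i * (theta * kappa)^-1.
    by rewrite -mulr_suml u1 mul1r.
  apply: ler_sum => i _; apply: ler_pM => //; [by rewrite mulr_ge0 // ltW | exact: ltW |].
  by rewrite ler_piMl // ltW.
have sle j : sk_step (fun=> 1) j <= (theta * kappa)^-1.
  rewrite lef_pV2 ?posrE //; last first.
    by apply: (sum_gt0 i0) => i; rewrite !mulr_gt0.
  apply: (@le_trans _ _ (theta * \sum_i u i * (N i j)%:R)).
    by apply: ler_wpM2l; [exact: ltW | exact: le_trans wb_col_ge (Nb j)].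
  rewrite mulr_sumr; apply: ler_sum => i _.
  case: (boolP (N i j)) => [/NK h|_]; last by rewrite !mulr0 !mulr_ge0 // ltW.
  rewrite mulr1 -[leLHS]mulr1; apply: ler_pM => //.
  - by rewrite mulr_ge0 // ltW.
  - by apply: ler_wpM2r; first exact: ltW.
move=> j j'; rewrite /gap !divr1 addrC subrK.
apply: (le_trans (sle j)); rewrite ler_pdivlMl ?exprn_gt0 //.
by rewrite exprS expr1 mulfK ?gt_eqF.
Qed.

(* The reference iterate is the same sequence run [T] steps ahead. *)
Lemma sk_dense_lower t i j : N i j ->
  (theta ^+ 6 * kappa ^+ 5 / 1280 <=
    rescale K v (iter t sk_step (fun=> 1)) i * K i j *
    iter t sk_step (fun=> 1) j) /\
  (theta ^+ 6 * kappa ^+ 5 / 1280 <=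
    rescale K v (iter t sk_step (fun=> 1)) i * K i j *
    iter t.+1 sk_step (fun=> 1) j).
Proof.
move=> Nij; have [k0 k1] := andP kappa01; have [th0 th1] := andP theta01.
have tk : 0 < theta * kappa by rewrite mulr_gt0.
have tk3 : 0 < (theta * kappa) ^+ 3 by rewrite exprn_gt0.
have [T gT] := sk_step_gap_small (ltac:(lra) : 0 < kappa / 4).
set z := fun t => iter t sk_step (fun=> 1 : R).
have z0 s k : 0 < z s k by apply: iter_sk_step_gt0.
have zh s : z (T + s)%N = iter s sk_step (z T) by rewrite addnC /z iterD.
(* The spread of the reference iterate. As the start is constant, [H] also bounds the oscillation of
   the ratio of start and reference, and this bound persists along the iteration. *)
set H := 40 / (theta * kappa) ^+ 3.
have H1 : 0 <= H - 1.
  rewrite subr_ge0 ler_pdivlMr // mul1r (@le_trans _ _ 1) //; last lra.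
  by rewrite exprn_ile1 ?mulr_ile1 // ltW.
have zT : osc (z T) (H - 1).
  move=> k k'; rewrite addrC subrK; apply: reference_spread => //.
  by have := gT 0%N; rewrite addn0.
have start : osc (fun k => z 0%N k / z T k) (H - 1).
  move=> k k' /=; rewrite !div1r -[leLHS]mul1r ler_pdivrMr // mulrAC.
  by rewrite ler_pdivlMr // mul1r; apply: zT.
have rosc s : osc (fun k => z s k / z (T + s)%N k) (H - 1).
  by rewrite zh; apply: ratio_osc_iter.
have [rQ rP] := reference_lower i j (z0 (T + t)%N) (gT t).
have x0 s k : 0 < rescale K v (z s) k by apply: (rescale_gt0 j0).
have P := rescale_lower j0 K0 v0 i j (z0 t) (z0 (T + t)%N) (rosc t).
have Q := rescale_lower i0 (fun j i => K0 i j) u0 j i (x0 t) (x0 (T + t)%N)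
  (rescale_osc_nonexpansive j0 K0 v0 (z0 (T + t)%N) (z0 t) H1 (rosc t)).
(* Dividing by [H] gives [1280 = 32 * 40] and the fifth powers; [K >= theta] on [N] gives the sixth
   power of [theta]. *)
have fin w : theta ^+ 2 * kappa ^+ 2 / 32 <= (1 + (H - 1)) * w ->
    theta ^+ 6 * kappa ^+ 5 / 1280 <= K i j * w.
  rewrite addrC subrK /H [X in _ <= X -> _]mulrAC ler_pdivlMr // => hw.
  have -> : theta ^+ 6 * kappa ^+ 5 / 1280 =
    theta * (theta ^+ 5 * kappa ^+ 5 / 1280) by ring.
  have : theta ^+ 5 * kappa ^+ 5 / 1280 <= w.
    by move: hw; rewrite exprMn; lra.
  have : 0 <= theta ^+ 5 * kappa ^+ 5 / 1280.
    by rewrite mulr_ge0 ?invr_ge0 ?ler0n // mulr_ge0 // exprn_ge0 // ltW.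
  move: (_ / _) => c c0 cw.
  by apply: ler_pM => //; [exact: ltW | exact: NK].
split; rewrite [_ * K i j]mulrC -[leRHS]mulrA; apply: fin.
- exact: le_trans rP P.
- apply: (le_trans rQ); rewrite mulrC; apply: (le_trans Q).
  by rewrite [rescale K v _ i * _]mulrC.
Qed.

Lemma sk_gap_rate t :
  osc (gap (iter t sk_step (fun=> 1)))
    ((1 - (theta * kappa) ^+ 6 / 1280) ^+ t * ((theta * kappa) ^- 2 - 1)).
Proof.
have [k0 k1] := andP kappa01; have [th0 th1] := andP theta01.
have tk : 0 < theta * kappa by rewrite mulr_gt0.
have tk1 : theta * kappa <= 1 by rewrite mulr_ile1 // ltW.
have dE : (theta * kappa) ^+ 6 / 1280 = kappa * (theta ^+ 6 * kappa ^+ 5 / 1280).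
  by ring.
have p0 : 0 <= theta ^+ 6 * kappa ^+ 5 / 1280.
  by rewrite mulr_ge0 ?invr_ge0 ?ler0n // mulr_ge0 // exprn_ge0 // ltW.
have p1 : (theta * kappa) ^+ 6 / 1280 <= 1.
  have : (theta * kappa) ^+ 6 <= 1 by rewrite exprn_ile1 // ltW.
  lra.
rewrite dE in p1 *; have low := sk_dense_lower.
move: (theta ^+ 6 * kappa ^+ 5 / 1280) p0 p1 low => p p0 p1 low.
apply: (gap_contract_iter t Na Nb ab) => //.
- by rewrite subr_ge0 invf_ge1 ?exprn_gt0 // exprn_ile1 // ltW.
- by move=> s i j /(low s)[].
- by move=> s i j /(low s)[].
- exact: sk_gap_osc_start.
Qed.

End WellBounded.
End UpperBoundOne.
End Iteration.

(** * From scaling factors to the matrices of the algorithm *)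

Section SinkhornMatrix.
Variables (R : realType) (m n : nat) (u : 'rV[R]_m.+1) (v : 'rV[R]_n.+1).
Variables (K : 'I_m.+1 -> 'I_n.+1 -> R).
Hypotheses (K0 : forall i j, 0 < K i j).
Hypotheses (u0 : forall i, 0 < u 0 i) (v0 : forall j, 0 < v 0 j).

Let y t := iter t (sk_step K (u 0) (v 0)) (fun=> 1).
Let x t := rescale K (v 0) (y t).

(** Even iterates follow a row step, so [x t] is computed from [y t]; in particular the iterate 0
    belongs to the column factor 1. The odd iterate in between pairs [x t] with [y t.+1]. *)
Lemma sinkhorn_doubleE (A : 'M[R]_(m.+1, n.+1)) t i j :
  (forall i j, A i j = u 0 i * K i j * v 0 j) ->
  sinkhorn A u v t.*2 i j = u 0 i * x t i * K i j * y t j * v 0 j.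
Proof.
move=> AE.
have y0 s k : 0 < y s k by apply: (iter_sk_step_gt0 ord0 ord0).
have x0 s k : 0 < x s k by apply: (rescale_gt0 ord0).
elim: t i j => [|t IH] i j.
  rewrite /= !mxE /x /y /= /rescale.
  under eq_bigr do rewrite AE -mulrA.
  rewrite AE -mulr_sumr.
  under [in RHS]eq_bigr do rewrite mulr1.
  set s := \sum_(_ < _) _.
  have s0 : 0 < s by apply: (sum_gt0 ord0) => k; rewrite mulr_gt0.
  by field; rewrite !gt_eqF.
rewrite doubleS /= odd_double /= -[sk_step _ _ _ _]/(y t.+1).
have colE i' j' : col_scale v (sinkhorn A u v t.*2) i' j' =
    u 0 i' * x t i' * K i' j' * y t.+1 j' * v 0 j'.
  rewrite !mxE IH; under eq_bigr do rewrite IH.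
  have -> : \sum_i0 u 0 i0 * x t i0 * K i0 j' * y t j' * v 0 j' =
      y t j' * v 0 j' * (y t.+1 j')^-1.
    rewrite /y /= -/(y t) /sk_step -/(x t) /rescale invrK mulr_sumr.
    by apply: eq_bigr => k _; ring.
  by field; rewrite !gt_eqF.
rewrite mxE colE mxE; under eq_bigr do rewrite colE.
have -> : \sum_j0 u 0 i * x t i * K i j0 * y t.+1 j0 * v 0 j0 =
    u 0 i * x t i * (x t.+1 i)^-1.
  rewrite [x t.+1]/x /rescale invrK mulr_sumr.
  by apply: eq_bigr => k _; ring.
by field; rewrite !gt_eqF.
Qed.

(** After a row step the row sums are exact, and column [j] is off by [v j] times the deviation of
    the inverse gap from 1. *)
Lemma sinkhorn_double_error (A : 'M[R]_(m.+1, n.+1)) t omega :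
  (forall i j, A i j = u 0 i * K i j * v 0 j) ->
  \sum_i u 0 i = 1 -> \sum_j v 0 j = 1 -> 0 <= omega ->
  osc (gap K (u 0) (v 0) (y t)) omega ->
  norm1 (row_sums (sinkhorn A u v t.*2) - u) +
  norm1 (col_sums (sinkhorn A u v t.*2) - v) <= omega.
Proof.
move=> AE u1 v1 om0 gosc.
have y0 s k : 0 < y s k by apply: (iter_sk_step_gt0 ord0 ord0).
have -> : norm1 (row_sums (sinkhorn A u v t.*2) - u) = 0.
  rewrite /norm1 big1 // => i _; rewrite !mxE.
  under eq_bigr do rewrite sinkhorn_doubleE //.
  rewrite (_ : \sum_j _ = u 0 i) ?subrr ?normr0 //.
  rewrite -[RHS]mulr1 -(rescale_sum ord0 K0 v0 i (y0 t)) mulr_sumr.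
  by apply: eq_bigr => k _; rewrite /x; ring.
rewrite add0r -[leRHS]mul1r -{1}v1 mulr_suml; apply: ler_sum => j _.
rewrite !mxE; under eq_bigr do rewrite sinkhorn_doubleE //.
have -> : \sum_i u 0 i * x t i * K i j * y t j * v 0 j =
    v 0 j * (gap K (u 0) (v 0) (y t) j)^-1.
  rewrite gap_invE -/(x t) mulr_sumr mulr_sumr.
  by apply: eq_bigr => k _; ring.
have -> : v 0 j * (gap K (u 0) (v 0) (y t) j)^-1 - v 0 j =
  v 0 j * ((gap K (u 0) (v 0) (y t) j)^-1 - 1) by ring.
rewrite normrM gtr0_norm //; apply: ler_wpM2l; first exact: ltW.
by rewrite ler_distl (gap_lower_upper ord0 ord0 K0 u0 v0 u1 v1 j (y0 t)).
Qed.

End SinkhornMatrix.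

(** * Counting the iterations *)

Theorem theorem1p2 (R : realType) :
  exists2 K : R, 0 < K &
  forall (m n : nat) (u : 'rV[R]_m.+1) (v : 'rV[R]_n.+1)
    (rho eps kappa eta : R) (C : 'M[R]_(m.+1, n.+1)),
    (forall i, 0 < u 0 i) -> (forall j, 0 < v 0 j) ->
    norm1 u = 1 -> norm1 v = 1 ->
    0 <= rho ->
    0 < eps <= 1 -> 0 < kappa <= 1 ->
    (forall i j, 0 < C i j) -> 0 < eta ->
    well_bounded rho kappa (eta *: C) u v ->
    exists k : nat,
      k%:R <= K * (expR (14 * rho) * kappa ^- 6 * (rho - ln eps - ln kappa)) /\
      let A := sinkhorn
        (diag_mx u *m map_mx expR (- (eta *: C)) *m diag_mx v) u v k in
      norm1 (row_sums A - u) + norm1 (col_sums A - v) <= eps.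
Proof.
(* Two half steps for each of at most [2560 * expR (6 * s) * (s + e) + 1] full steps give 5120; the
   rounding term 2 is at most [10 * (s + e)] by [L5]. *)
exists 5130; first by rewrite ltr0n.
move=> m n u v rho eps kappa eta C u0 v0 nu nv rho0 eps01 kappa01
  C0 eta0 wb.
have [[e0 e1] [k0 k1]] := (andP eps01, andP kappa01).
have sum1 d (w : 'rV[R]_d) : (forall i, 0 < w 0 i) -> norm1 w = 1 ->
    \sum_i w 0 i = 1.
  by move=> w0 <-; apply: eq_bigr => i _; rewrite gtr0_norm.
have [u1 v1] := (sum1 _ _ u0 nu, sum1 _ _ v0 nv).
set A := _ *m diag_mx v.
pose K i j := expR (- (eta *: C) i j).
have AE i j : A i j = u 0 i * K i j * v 0 j.
  by rewrite /A /K mul_mx_diag mxE mul_diag_mx !mxE.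
have K0 i j : 0 < K i j by apply: expR_gt0.
have K1 i j : K i j <= 1.
  by rewrite -expR0 ler_expR !mxE oppr_le0 mulr_ge0 // ltW.
pose N i j := (eta *: C) i j <= rho.
have NK i j : N i j -> expR (- rho) <= K i j by rewrite ler_expR /N !mxE lerN2.
have Na i : row_bound rho (eta *: C) v <= \sum_j v 0 j * (N i j)%:R.
  exact: (@bigmin_le _ _ _ _ i).
have Nb j : col_bound rho (eta *: C) u <= \sum_i u 0 i * (N i j)%:R.
  exact: (@bigmin_le _ _ _ _ j).
set s := rho - ln kappa; set e := - ln eps.
have e_ge0 : 0 <= e by rewrite oppr_ge0 ln_le0.
have s0 : 0 <= s by rewrite subr_ge0 (le_trans _ rho0) // ln_le0.
have -> : rho - ln eps - ln kappa = s + e by rewrite /s /e; ring.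
have epsE : eps = expR (- e) by rewrite opprK lnK.
have tkE : expR (- rho) * kappa = expR (- s) by rewrite opprB addrC expRD lnK.
have theta01 : 0 < expR (- rho) <= 1 by rewrite expR_gt0 -expR0 ler_expR oppr_le0.
have rate := sk_gap_rate ord0 ord0 K0 u0 v0 u1 v1 K1 Na Nb wb kappa01 theta01 NK.
have WE : expR (- s) ^- 2 = expR (2 * s).
  by rewrite -expRM_natl -expRN mulrN opprK.
rewrite tkE WE in rate.
have L0 : 0 <= s + e by exact: addr_ge0.
(* If the initial oscillation is already at most [eps], the iterate 0 suffices. Otherwise [s + e] is
   bounded away from 0, which absorbs the rounding of the step count. *)
have [small|big] := lerP (expR (2 * s) - 1) eps.
  exists 0%N; split.
    by rewrite !mulr_ge0 ?ler0n ?expR_ge0 ?invr_ge0 ?exprn_ge0 ?(ltW k0).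
  apply: le_trans small; apply: (sinkhorn_double_error (t := 0) K0 u0 v0 AE) => //.
    by rewrite subr_ge0 -expR0 ler_expR mulr_ge0.
  by have := rate 0%N; rewrite expr0 mul1r.
have L5 : 1 / 5 <= s + e.
  have := expR_ge1Dx (- e); have := expR_ge1Dx (- (2 * s)).
  have := expRxMexpNx_1 (2 * s); have := expR_gt0 (2 * s).
  move: big; rewrite epsE; nra.
set d := expR (- s) ^+ 6 / 1280 in rate.
have d0 : 0 < d by rewrite mulr_gt0 ?invr_gt0 ?ltr0n ?exprn_gt0 ?expR_gt0.
have dV : d^-1 = 1280 * expR (6 * s).
  by rewrite /d invf_div -expRM_natl mulrN expRN invrK.
have d1 : d <= 1.
  have : expR (- s) ^+ 6 <= 1.
    by rewrite exprn_ile1 ?expR_ge0 // -expR0 ler_expR oppr_le0.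
  by rewrite /d; lra.
(* The logarithm of [expR (2 * s) / eps] is [2 * s + e], at most [2 * (s + e)]. *)
set t := (Num.truncn (d^-1 * (2 * (s + e)))).+1.
have t1 : t%:R <= d^-1 * (2 * (s + e)) + 1.
  rewrite /t -natr1 lerD2r truncn_le mulr_ge0 ?invr_ge0 ?(ltW d0) //.
  by rewrite mulr_ge0.
have td : d^-1 * (2 * (s + e)) <= t%:R by apply/ltW/truncnS_gt.
exists t.*2; split.
  (* The rate [d] costs [expR (6 * s)], that is [expR (6 * rho) * kappa ^- 6]; the remaining
     [expR (8 * rho)] is at least 1. *)
  have -> : expR (14 * rho) * kappa ^- 6 = expR (8 * rho) * expR (6 * s).
    have -> : 6 * s = 6 * rho + - (6 * ln kappa) by rewrite /s; ring.
    rewrite expRD expRN [expR (6 * ln _)]expRM_natl lnK // mulrA -expRD; congr (expR _ * _).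
    by ring.
  have r1 : 1 <= expR (8 * rho) by rewrite -expR0 ler_expR mulr_ge0.
  have s1 : 1 <= expR (6 * s) by rewrite -expR0 ler_expR mulr_ge0.
  have : t.*2%:R <= 5130 * (expR (6 * s) * (s + e)).
    rewrite -mul2n natrM; move: t1; rewrite dV.
    set E := expR (6 * s) in s1 *; move: (t%:R : R) => T hT; nra.
  move=> /le_trans; apply; rewrite ler_wpM2l ?ler0n // -mulrA.
  by rewrite ler_peMl //; apply: mulr_ge0; [exact: expR_ge0 | exact: L0].
apply: (sinkhorn_double_error (t := t) K0 u0 v0 AE) => //; first exact: ltW.
move=> j j'; have /le_trans := rate t j j'; apply; rewrite ler_wpM2r //.
  rewrite ltW // divr_gt0 //; first apply: (sk_step_gt0 ord0 ord0) => // k.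
    exact: (iter_sk_step_gt0 ord0 ord0).
  exact: (iter_sk_step_gt0 ord0 ord0).
rewrite lerD2l; apply: (@le_trans _ _ ((1 - d) ^+ t * expR (2 * s))).
  by rewrite ler_wpM2l ?exprn_ge0 ?subr_ge0 // gerBl.
apply: geometric_le; rewrite ?expR_gt0 // epsE -expRN -expRD expRK opprK.
rewrite -ler_pdivrMl //; apply: le_trans td.
by rewrite ler_wpM2l ?invr_ge0 ?(ltW d0) //; lra.
Qed.
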